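(* Let $\hat G$ be a plane embedding of a connected 4-regular planar graph $G$, and let $c$ be a cut vertex of $G$. Let $K_1$ be one connected component of $G-c$, and let $K_2$ be the union of the remaining components of $G-c$. For $i=1,2$: - let $G_i$ be the subgraph of $G$ consisting of $K_i$, the vertex $c$, and all edges of $G$ with both ends in $V(K_i)\cup\{c\}$; - let $G'_i$ be the graph obtained from $G_i$ by adding one self-loop at $c$, so that $G'_i$ is 4-regular; - let $\hat G'_i$ be a plane embedding of $G'_i$ that extends the embedding of $G_i$ induced by $\hat G$. Let $C$, $C_1$, $C_2$ be the threaded circuit partitions of $\hat G$, $\hat G'_1$, $\hat G'_2$, respectively. Then $|C| = |C_1| + |C_2| - 1$.
   Context: Graphs may contain loops and multiple edges. A plane graph is a graph with a fixed planar embedding, encoded by the cyclic counterclockwise order of edge-ends (half-edges) at each vertex; a loop contributes two edge-ends at its vertex. In a 4-regular plane graph, the two threads with midpoint $\beta$ are defined as follows. Let $h_0,h_1,h_2,h_3$ be the edge-ends at $\beta$ in cyclic order. The threads are the pairs of non-consecutive edge-ends $\{h_0,h_2\}$ and $\{h_1,h_3\}$. Equivalently, a thread is a two-edge path $(\alpha,\beta,\gamma)$ whose two edge-ends at $\beta$ are not contiguous in the cyclic order around $\beta$. For each edge traversal $(\alpha,\beta)$ there is a unique thread $(\alpha,\beta,\gamma)$, and $(\beta,\gamma)$ is called the next edge. A circuit is a cyclic sequence of distinct edges $(e_0,\dots,e_{k-1})$ with $e_i=(u_i,u_{i+1})$, indices mod $k$. A circuit is threaded if each $(u_{j-1},u_j,u_{j+1})$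 is a thread. A threaded circuit partition of a 4-regular plane graph is a set of threaded circuits such that every edge lies in exactly one of them. Every 4-regular plane graph has a unique threaded circuit partition. *)

(* Defs.v *)
(* Plane graphs as rotation systems (combinatorial maps). *)
From mathcomp Require Import all_boot.
Set Implicit Arguments. Unset Strict Implicit. Unset Printing Implicit Defensive.

Section PlaneMaps.
Variable D : finType.        (* edge-ends (half-edges) *)
Variables alpha sigma : D -> D.
(* alpha d = the other end of the edge of d  (edges = alpha-orbits);
   sigma d = the next edge-end counterclockwise around the vertex of d
   (vertices = sigma-orbits, the cyclic order is the rotation). *)

Definition same_vertex (h h' : D) : bool := fconnect sigma h h'.

Definition glink : rel D :=
  fun x y => [|| alpha x == y, sigma x == y | sigma y == x].

Definition connected_map : Prop := forall x y : D, connect glink x y.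

(* Euler's formula V + F = E + 2 * (#components): genus 0, i.e. the rotation
   system is a plane embedding.  Faces are the orbits of sigma \o alpha. *)
Definition plane_map : Prop :=
  [/\ involutive alpha, (forall d, alpha d != d), injective sigma &
      fcard sigma predT + fcard (sigma \o alpha) predT
        = fcard alpha predT + 2 * n_comp glink predT].

(* every vertex has exactly four edge-ends (a loop contributes two) *)
Definition four_regular : Prop := forall d : D, order sigma d = 4.

Definition thread (h h' : D) : bool :=
  [&& same_vertex h h', h != h', sigma h != h' & sigma h' != h].

(* A threaded circuit: cyclic sequence of edge traversals d_0 ... d_(k-1)
   (d_i leaves u_i, alpha d_i arrives at u_(i+1)), k >= 1, with distinct
   edges, and each consecutive pair forming a thread at u_(i+1). *)
Definition threaded_circuit (s : seq D) : bool :=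
  [&& s != [::], uniq (s ++ map alpha s) &
      cycle (fun x y => thread (alpha x) y) s].

Definition edge_in (d : D) (s : seq D) : bool := (d \in s) || (alpha d \in s).

Definition threaded_circuit_partition (C : seq (seq D)) : Prop :=
  (forall s, s \in C -> threaded_circuit s) /\
  (forall d : D, count (edge_in d) C = 1).

(* ---- cut vertex data; the vertex c is the sigma-orbit of the dart c0 ---- *)
Variable c0 : D.
Definition at_c (d : D) : bool := same_vertex c0 d.

Definition link_minus_c : rel D :=
  fun x y => [&& ~~ at_c x, ~~ at_c y & glink x y].

Definition cut_vertex : Prop :=
  exists x y, [/\ ~~ at_c x, ~~ at_c y & ~~ connect link_minus_c x y].

Definition inK1 (k1 d : D) : bool := ~~ at_c d && connect link_minus_c k1 d.
Definition inK2 (k1 d : D) : bool := ~~ at_c d && ~~ connect link_minus_c k1 d.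

Definition inV_ (K : pred D) (d : D) : bool := at_c d || K d.
Definition dart_of_sub (K : pred D) (d : D) : bool :=
  inV_ K d && inV_ K (alpha d).

(* (D', alpha', sigma') is (an isomorphic copy, via f, of) G_K with one
   self-loop {l, alpha' l} added at c, with a rotation system extending the
   one induced on G_K by sigma. *)
Definition loop_extension (K : pred D) (D' : finType)
    (alpha' sigma' : D' -> D') (f : D -> D') (l : D') : Prop :=
  [/\ {in dart_of_sub K &, injective f},
      (forall x : D', [\/ x = l, x = alpha' l |
                          exists2 d, dart_of_sub K d & x = f d]),
      (forall d, dart_of_sub K d -> f d != l /\ f d != alpha' l) &
    [/\ (forall d, dart_of_sub K d -> alpha' (f d) = f (alpha d)),
      (forall d, dart_of_sub K d -> ~~ at_c d -> sigma' (f d) = f (sigma d)) &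
      (forall d, dart_of_sub K d -> at_c d ->
          fconnect sigma' (f d) l /\ fconnect sigma' (f d) (alpha' l))]].

End PlaneMaps.

(* Main.v *)
(* In a 4-regular map the next dart of a threaded circuit is
   tau d = sigma (sigma (alpha d)), and each circuit accounts for two tau-orbits,
   one for each direction of traversal; hence 2 |C| is the number of tau-orbits.
   By parity, c has exactly two darts a, b towards K1 and two darts towards K2,
   and G - c has exactly two components.  Cut c open into four univalent
   vertices: the step tau becomes [cutstep], whose orbit through a ends at b,
   since reversal maps this orbit to itself and cannot fix an inner point.  So
   if the darts of the two sides do not alternate around c, glueing c back
   merges the orbits of a path on one side and a path on the other, then splits
   the result: the number of orbits is unchanged.  The same holds in G'_i, where
   the new loop plays the role of the other side and contributes one orbit.
   Alternation is excluded by planarity: glueing c back from an alternating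
   position does not leave enough faces for Euler's formula, given the inequality
   V + F <= E + 2 (number of components) for the map cut open at c. *)
Require Import Defs.
From mathcomp Require Import all_boot.
From mathcomp Require Import fingroup perm zify.
Set Implicit Arguments. Unset Strict Implicit. Unset Printing Implicit Defensive.

(** * Invariant sets and the effect of a transposition on orbit counts *)

Definition stable (T : finType) (f : T -> T) (A : {set T}) : bool :=
  [forall x in A, f x \in A].

Lemma stableP (T : finType) (f : T -> T) (A : {set T}) :
  reflect (forall x, x \in A -> f x \in A) (stable f A).
Proof. exact: forall_inP. Qed.

Lemma porbit_stable (T : finType) (s : {perm T}) (A : {set T}) x y :
  stable s A -> x \in A -> y \in porbit s x -> y \in A.
Proof.
move=> /stableP sA xA /porbitP[i ->]; elim: i => [|i IH]; first by rewrite perm1.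
by rewrite expgSr permM sA.
Qed.

Lemma stable_porbit (T : finType) (s : {perm T}) x : stable s (porbit s x).
Proof.
by apply/stableP => y /porbitP[i ->]; rewrite -permM -expgSr mem_porbit.
Qed.

Lemma stable_tperm (T : finType) (x y : T) (A : {set T}) :
  (x \in A) = (y \in A) -> stable (tperm x y) A.
Proof. by move=> xy; apply/stableP => z; case: tpermP => // ->; rewrite xy. Qed.

Lemma stableM (T : finType) (s t : {perm T}) (A : {set T}) :
  stable s A -> stable t A -> stable (s * t)%g A.
Proof.
by move=> /stableP sA /stableP tA; apply/stableP => x xA; rewrite permM tA ?sA.
Qed.

Lemma stableC (T : finType) (s : {perm T}) (A : {set T}) :
  stable s A -> stable s (~: A).
Proof.
move=> /stableP sA; apply/stableP => x; rewrite !inE; apply: contra => sxA.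
have /eqP E : s @: A == A.
  rewrite eqEcard (card_imset _ (@perm_inj _ s)) leqnn andbT.
  by apply/subsetP => _ /imsetP[y yA ->]; exact: sA.
by move: sxA; rewrite -{1}E (mem_imset _ _ (@perm_inj _ s)).
Qed.

(** Inversion preserves orbits and reverses products, so the transposition may stand on the right,
    where it acts after [s]. *)
Lemma porbits_tperm_mul (T : finType) (s : {perm T}) x y :
  #|porbits (s * tperm x y)%g| + (x \notin porbit s y).*2
    = #|porbits s| + (x != y).
Proof.
by rewrite -porbitsV invMg tpermV -(porbitV s) porbits_mul_tperm porbitsV.
Qed.

Lemma porbits_join (T : finType) (s : {perm T}) x y :
  x \notin porbit s y -> #|porbits s| = #|porbits (s * tperm x y)%g|.+1.
Proof.
move=> nxy; have := porbits_tperm_mul s x y; rewrite nxy.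
have -> : x != y by apply: contraNneq nxy => ->; exact: porbit_id.
lia.
Qed.

Lemma porbits_cut (T : finType) (s : {perm T}) x y :
  x != y -> x \in porbit s y -> #|porbits (s * tperm x y)%g| = #|porbits s|.+1.
Proof. move=> nxy oxy; have := porbits_tperm_mul s x y; rewrite nxy oxy; lia. Qed.

Lemma mulg_tpermK (T : finType) (s : {perm T}) x y :
  (s * tperm x y * tperm x y)%g = s.
Proof. by rewrite -mulgA tperm2 mulg1. Qed.

(** If both points were still on one orbit, the same transposition would split once more; but
    applying it twice gives back [s], with its original orbit count. *)
Lemma porbit_cut (T : finType) (s : {perm T}) x y :
  x != y -> x \in porbit s y -> x \notin porbit (s * tperm x y)%g y.
Proof.
move=> nxy oxy; apply/negP => oxy'.
have := porbits_cut nxy oxy; have := porbits_cut nxy oxy'.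
rewrite mulg_tpermK; lia.
Qed.

Lemma porbit_join (T : finType) (s : {perm T}) x y :
  x \notin porbit s y -> x \in porbit (s * tperm x y)%g y.
Proof.
move=> nxy; apply: contraNT (nxy) => nxy'.
have := porbits_join nxy; have := porbits_join nxy'; rewrite mulg_tpermK; lia.
Qed.

Lemma porbit_fix (T : finType) (s : {perm T}) x y :
  s x = x -> (y \in porbit s x) = (y == x).
Proof.
move=> sx; apply/idP/eqP => [|->]; last exact: porbit_id.
have st : stable s [set x] by apply/stableP => z /set1P->; rewrite sx inE.
by move=> /(porbit_stable st (set11 x)) /set1P.
Qed.

(** Bridge from the [fcard] of Euler's formula to permutation orbits: [porbit s] maps the canonical
    roots bijectively onto the orbits. *)
Lemma fcard_porbits (T : finType) (s : {perm T}) (f : T -> T) :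
  s =1 f -> fcard f predT = #|porbits s|.
Proof.
move=> sf; have fs : frel f =2 frel s by move=> x y; rewrite /= sf.
have cf x y : fconnect s x y = (y \in porbit s x).
  apply/idP/porbitP => [/iter_findex <-|[i ->]].
    by exists (findex s x y); rewrite permX.
  by rewrite permX fconnect_iter.
have sym := fconnect_sym (@perm_inj _ s).
rewrite (eq_n_comp (eq_connect fs)); transitivity #|froots s|.
  by apply: eq_card => x; rewrite !inE andbT.
have inj : {in froots s &, injective (porbit s)}.
  move=> x y /eqP rx /eqP ry E; rewrite -rx -ry; apply/eqP.
  by rewrite root_connect // cf -eq_porbit_mem E.
rewrite -(card_in_imset inj); apply: eq_card => B.
apply/imsetP/imsetP => -[x _ ->]; first by exists x.
exists (froot s x); first exact: roots_root.
by apply/eqP; rewrite eq_porbit_mem -cf -root_connect // root_root.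
Qed.

(** * Euler's inequality for arbitrary rotation systems *)

(* [X] meets every nonempty subset closed under [a] and [s], i.e. every
   connected component of the map. *)
Definition hits (T : finType) (a s : T -> T) (X : {set T}) : bool :=
  [forall B : {set T}, (stable a B && stable s B && [disjoint B & X]) ==> (B == set0)].

Lemma hitsP (T : finType) (a s : T -> T) (X : {set T}) :
  reflect (forall B : {set T}, stable a B -> stable s B -> [disjoint B & X] -> B = set0)
          (hits a s X).
Proof.
apply: (iffP forallP) => H B; first move=> *.
  by apply/eqP/(implyP (H B))/andP; split=> //; apply/andP.
by apply/implyP => /andP[/andP[? ?] ?]; apply/eqP/H.
Qed.

(* Nonnegativity of the genus.  A transposition that splits a cycle of [s]
   either keeps the components or separates two of them, in which case it also
   splits a face. *)
Lemma euler_le (T : finType) (a s : {perm T}) (X : {set T}) :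
  hits a s X ->
  #|porbits s| + #|porbits a| + #|porbits (a * s)%g| <= #|T| + 2 * #|X|.
Proof.
move: {2}#|_| (leqnn #|[set z | s z != z]|) => n.
elim: n s X => [|n IH] s X ltn hX.
  have s1 : s = 1%g.
    apply/permP => z; rewrite perm1; apply/eqP; move: ltn.
    rewrite leqn0 cards_eq0 => /eqP/setP/(_ z); rewrite !inE.
    by move/negbT; rewrite negbK.
  rewrite s1 mulg1; have : #|porbits (1%g : {perm T})| <= #|T| by exact: leq_imset_card.
  (* For trivial [s] the components are the orbits of [a], each of which meets [X]; this bounds both
     the edge term and the face term. *)
  suff : #|porbits a| <= #|X| by lia.
  apply: (leq_trans _ (leq_imset_card (porbit a) X)); apply: subset_leq_card.
  apply/subsetP => _ /imsetP[z _ ->].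
  have [x /andP[xz xX]|no] := pickP [pred x | (x \in porbit a z) && (x \in X)].
    by apply/imsetP; exists x => //; apply/eqP; rewrite eq_sym eq_porbit_mem.
  have /hitsP/(_ (porbit a z)) := hX; rewrite stable_porbit s1 => P0.
  have /setP/(_ z) : porbit a z = set0.
    apply: P0 => //; first by apply/stableP => y; rewrite perm1.
    by apply/pred0P => y; exact: no.
  by rewrite porbit_id inE.
have [x sx|s1] := pickP [pred x | s x != x]; last first.
  by apply: IH => //; rewrite eq_card0 // => x; rewrite inE; exact: s1.
(* This [s'] detaches [x] from its cycle as a fixed point, so fewer points are moved. *)
set y := s x; pose t : {perm T} := tperm x y; pose s' : {perm T} := (s * t)%g.
have nxy : x != y by rewrite eq_sym.
have s'x : s' x = x by rewrite permM tpermR.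
have ss' : s = (s' * t)%g by rewrite mulg_tpermK.
have lt' : #|[set z | s' z != z]| <= n.
  rewrite -ltnS; apply: leq_trans ltn; apply: proper_card; apply/properP; split; last first.
    by exists x; rewrite !inE ?s'x ?eqxx.
  apply/subsetP => z; rewrite !inE; apply: contra => /eqP sz.
  have zx : z != x by apply: contraNneq sx => <-; rewrite sz.
  have zy : z != y.
    by apply: contraNneq zx => zy; apply/eqP/(@perm_inj _ s); rewrite -/y sz.
  by rewrite permM sz tpermD // eq_sym.
clearbody s'.
have Cs : #|porbits s'| = #|porbits s|.+1.
  have nx : x \notin porbit s' y by rewrite porbit_sym porbit_fix // eq_sym.
  by rewrite ss' (porbits_join nx).
have sst (B : {set T}) : (x \in B) = (y \in B) -> stable s' B -> stable s B.
  by move=> xyB s'B; rewrite ss' stableM // stable_tperm.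
have Es : (a * s' * tperm x y)%g = (a * s)%g by rewrite -mulgA ss'.
(* If [X] still suffices, passing from [s'] back to [s] loses one vertex and gains at most one
   face. *)
have [hX'|] := boolP (hits a s' X).
  have := IH s' X lt' hX'.
  have := porbits_tperm_mul (a * s')%g x y; rewrite Es nxy.
  lia.
rewrite negb_forall => /existsP[B]; rewrite negb_imply.
case/andP=> /andP[/andP[aB s'B] BX] B0.
have xyB : (x \in B) != (y \in B).
  by apply: contra B0 => /eqP /sst/(_ s'B) sB; apply/eqP/(hitsP _ _ _ hX).
(* [B] is a component cut off from [X]. Its point among [x] and [y] is added to [X], which costs 2
   in the bound; one vertex and one face more for [s'] pay for it. *)
pose z := if x \in B then x else y.
have hX' : hits a s' (z |: X).
  apply/hitsP => B' aB' s'B'; rewrite -setI_eq0 setIUr setU_eq0 !setI_eq0.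
  rewrite disjoint_sym disjoints1 => /andP[zB' B'X].
  have [xyB'|xyB'] := eqVneq (x \in B') (y \in B').
    by apply: (hitsP _ _ _ hX) => //; exact: sst.
  have stU (f : T -> T) : stable f B -> stable f B' -> stable f (B :|: B').
    move=> /stableP fB /stableP fB'; apply/stableP => w; rewrite !inE.
    by case/orP=> [/fB|/fB'] ->; rewrite ?orbT.
  have : B :|: B' = set0.
    apply: (hitsP _ _ _ hX); first exact: stU.
      apply: sst; last exact: stU.
      rewrite !inE; move: xyB xyB' zB'; rewrite /z.
      by case: (x \in B); case: (y \in B); case: (x \in B'); case: (y \in B').
    by rewrite -setI_eq0 setIUl setU_eq0 !setI_eq0 BX.
  by move/eqP; rewrite setU_eq0 => /andP[_ /eqP].
have nas : x \notin porbit (a * s')%g y.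
  have sB : stable (a * s')%g B by exact: stableM.
  apply/negP => oxy; move: xyB; have [xB|xB] := boolP (x \in B).
    by rewrite (porbit_stable sB xB) // porbit_sym.
  have [yB|//] := boolP (y \in B).
  by rewrite (porbit_stable sB yB oxy) in xB.
have Ef := porbits_join nas; rewrite Es in Ef.
have := IH s' _ lt' hX'; have : #|z |: X| <= #|X|.+1 by rewrite cardsU1; case: (_ \notin _).
lia.
Qed.

(** * Planarity excludes alternating sides at c *)

(* [s] is recovered from the permutation [u0] fixing the four darts at c by three
   transpositions, ordered so that the second and, when the first one splits a
   face, also the third one merge two faces. *)
Lemma no_alternation (T : finType) (a s : {perm T}) (A : {set T}) x :
  uniq [:: x; s x; s (s x); s (s (s x))] -> s (s (s (s x))) = x ->
  #|T| + 2 <= #|porbits s| + #|porbits a| + #|porbits (a * s)%g| ->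
  stable a A ->
  (forall d, d \in A -> d \notin [:: x; s x; s (s x); s (s (s x))] -> s d \in A) ->
  (forall B : {set T}, stable a B ->
     (forall d, d \in B -> d \notin [:: x; s x; s (s x); s (s (s x))] -> s d \in B) ->
     x \notin B -> s x \notin B -> B = set0) ->
  x \in A -> s (s x) \in A -> s x \notin A -> s (s (s x)) \notin A -> False.
Proof.
set x1 := s x; set x2 := s x1; set x3 := s x2.
move=> U sx3 planar aA sA atoms Ax Ax2 nAx1 nAx3.
have : [&& x != x1, x != x2, x != x3, x1 != x2, x1 != x3 & x2 != x3].
  by move: U => /=; rewrite !inE !negb_or -!andbA andbT.
case/and5P=> n01 n02 n03 n12 /andP[n13 n23].
have n10 := n01; have n20 := n02; have n30 := n03.
have n21 := n12; have n31 := n13; have n32 := n23.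
rewrite eq_sym in n10; rewrite eq_sym in n20; rewrite eq_sym in n30.
rewrite eq_sym in n21; rewrite eq_sym in n31; rewrite eq_sym in n32.
have sx : s x = x1 by []. have sx1 : s x1 = x2 by []. have sx2 : s x2 = x3 by [].
clearbody x3; clearbody x2; clearbody x1.
(* The 4-cycle at c is dismantled: [u2] detaches [x1], [u1] detaches [x3], and [u0] separates [x]
   from [x2]. *)
have [u2 D2] : {u : {perm T} | u = (s * tperm x2 x1)%g} by eexists.
have [u1 D1] : {u : {perm T} | u = (u2 * tperm x x3)%g} by eexists.
have [u0 D0] : {u : {perm T} | u = (u1 * tperm x x2)%g} by eexists.
have u2x : u2 x = x2 by rewrite D2 permM sx tpermR.
have u2x1 : u2 x1 = x1 by rewrite D2 permM sx1 tpermL.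
have u2x2 : u2 x2 = x3 by rewrite D2 permM sx2 tpermD.
have u2x3 : u2 x3 = x by rewrite D2 permM sx3 tpermD.
have u1x : u1 x = x2 by rewrite D1 permM u2x tpermD.
have u1x1 : u1 x1 = x1 by rewrite D1 permM u2x1 tpermD.
have u1x2 : u1 x2 = x by rewrite D1 permM u2x2 tpermR.
have u1x3 : u1 x3 = x3 by rewrite D1 permM u2x3 tpermL.
have u0x : u0 x = x by rewrite D0 permM u1x tpermR.
have u0x1 : u0 x1 = x1 by rewrite D0 permM u1x1 tpermD.
have u0x2 : u0 x2 = x2 by rewrite D0 permM u1x2 tpermL.
have u0x3 : u0 x3 = x3 by rewrite D0 permM u1x3 tpermD.
have u0D d : d \notin [:: x; x1; x2; x3] -> u0 d = s d.
  rewrite !inE !negb_or => /and4P[d0 d1 d2 d3].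
  have sinj := @perm_inj _ s.
  have e0 : x != s d by rewrite -sx3 (inj_eq sinj) eq_sym.
  have e1 : x1 != s d by rewrite -sx (inj_eq sinj) eq_sym.
  have e2 : x2 != s d by rewrite -sx1 (inj_eq sinj) eq_sym.
  have e3 : x3 != s d by rewrite -sx2 (inj_eq sinj) eq_sym.
  have u2d : u2 d = s d by rewrite D2 permM tpermD.
  have u1d : u1 d = s d by rewrite D1 permM u2d tpermD.
  by rewrite D0 permM u1d tpermD.
have E1 : u1 = (u0 * tperm x x2)%g by rewrite D0 mulg_tpermK.
have E2 : u2 = (u1 * tperm x x3)%g by rewrite D1 mulg_tpermK.
have E3 : s = (u2 * tperm x2 x1)%g by rewrite D2 mulg_tpermK.
have C0 : #|porbits u0| = #|porbits u1|.+1.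
  by rewrite E1; apply: porbits_join; rewrite porbit_sym porbit_fix.
have C1 : #|porbits u1| = #|porbits u2|.+1.
  by rewrite E2; apply: porbits_join; rewrite porbit_fix.
have C2 : #|porbits u2| = #|porbits s|.+1.
  by rewrite E3; apply: porbits_join; rewrite porbit_fix.
have stu0 : stable u0 A.
  apply/stableP => d dA; have [|dx] := boolP (d \in [:: x; x1; x2; x3]).
    by rewrite !inE => /or4P[]/eqP E; rewrite E ?u0x ?u0x1 ?u0x2 ?u0x3 -?E.
  by rewrite u0D // sA.
(* One dart from each side meets every component of the opened map. *)
have hX : hits a u0 [set x; x1].
  apply/hitsP => B aB /stableP uB BX; apply: atoms => //.
  - by move=> d dB dx; rewrite -u0D // uB.
  - by apply: contraL BX => xB; apply/pred0Pn; exists x; rewrite /= xB !inE eqxx.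
  - by apply: contraL BX => xB; apply/pred0Pn; exists x1; rewrite /= xB !inE eqxx orbT.
have := euler_le hX; rewrite cards2 n01.
have [v0 V0] : {v : {perm T} | v = (a * u0)%g} by eexists.
have [v1 V1] : {v : {perm T} | v = (v0 * tperm x x2)%g} by eexists.
have [v2 V2] : {v : {perm T} | v = (v1 * tperm x x3)%g} by eexists.
have Ev : (a * s)%g = (v2 * tperm x2 x1)%g by rewrite E3 E2 E1 V2 V1 V0 !mulgA.
have stv0 : stable v0 A by rewrite V0; exact: stableM.
have stv1 : stable v1 A by rewrite V1; apply: stableM => //; apply: stable_tperm; rewrite Ax Ax2.
have nv1 : x \notin porbit v1 x3.
  by apply: contra nAx3 => o; rewrite (porbit_stable stv1 Ax) // porbit_sym.
have F0 := porbits_tperm_mul v0 x x2; rewrite n02 -V1 in F0.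
have F1 := porbits_join nv1; rewrite -V2 in F1.
have F2 := porbits_tperm_mul v2 x2 x1; rewrite n21 -Ev in F2.
(* If the first transposition splits a face, the part through [x2] lies in [A] and avoids [x] and
   [x3]. It survives the second transposition, so it still misses [x1], and the third one merges. *)
have key : x \notin porbit v0 x2 \/ x2 \notin porbit v2 x1.
  have [o|] := boolP (x \in porbit v0 x2); [right | by left].
  have nx : x \notin porbit v1 x2 by rewrite V1; exact: porbit_cut.
  have PA y : y \in porbit v1 x2 -> y \in A by exact: porbit_stable.
  have st2 : stable v2 (porbit v1 x2).
    rewrite V2; apply: stableM; first exact: stable_porbit.
    by apply: stable_tperm; rewrite (negbTE nx); apply/esym; apply: contraNF nAx3 => /PA.
  apply: contra nAx1 => o2; apply: PA; apply: porbit_stable st2 (porbit_id _ _) _.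
  by rewrite porbit_sym.
rewrite -V0 => EL.
(* [u0] has three more orbits than [s], so Euler's inequality and planarity make [v0] have fewer
   orbits than [a * s]. But of the three transpositions at least two merge, so [a * s] has fewer
   orbits than [v0]. *)
move: EL planar C0 C1 C2 F0 F1 F2 => /[!mulnS] /[!muln0].
move: #|porbits u0| #|porbits u1| #|porbits u2| #|porbits s| #|porbits a|.
move: #|porbits v0| #|porbits v1| #|porbits v2| #|porbits (a * s)%g| #|T|.
by case: key => ->; clear; lia.
Qed.

(** * Orbits of the threading step when c is cut open and glued back *)

Lemma involution_even (T : finType) (f : T -> T) (A : {set T}) :
  involutive f -> stable f A -> {in A, forall z, f z != z} -> ~~ odd #|A|.
Proof.
move=> fK /stableP fA fx; have finj := inv_inj fK.
have cA : fclosed f A.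
  apply: intro_closed; first exact: fconnect_sym.
  by move=> x y /eqP<-; exact: fA.
rewrite -(fcard_order_set finj (n := 2) (a := A)) ?muln2 ?odd_double //.
apply/subsetP => z /fx zf; apply/eqP.
rewrite (@order_cycle _ f [:: z; f z]) ?inE ?eqxx //=; first by rewrite fK !eqxx.
by rewrite inE eq_sym zf.
Qed.

Lemma porbit_pre (T : finType) (s : {perm T}) x y :
  (s y \in porbit s x) = (y \in porbit s x).
Proof. by have := porbit_perm s 1 y; rewrite expg1 porbit_sym => ->; rewrite porbit_sym. Qed.

(* The orbit of [x] under [a * th] is invariant under both involutions, so it has
   even size, and [th] has a second fixed point on it. *)
Lemma mirror_orbit (T : finType) (a th : {perm T}) (A : {set T}) x x1 :
  involutive a -> (forall d, a d != d) -> involutive th ->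
  stable a A -> stable th A -> x \in A -> th x = x ->
  (forall d, d \in A -> th d = d -> d = x \/ d = x1) ->
  x1 \in porbit (a * th)%g x.
Proof.
move=> aK afix thK aA thA Ax thx fixA.
have wE z : (a * th)%g z = th (a z) by rewrite permM.
have wA : stable (a * th)%g A by exact: stableM.
(* Writing w for [a * th], reversal reads w (a (w z)) = a z, and w (a x) = x because [th] fixes
   [x]. *)
have aO : stable a (porbit (a * th)%g x).
  apply/stableP => z /porbitP[i ->]; elim: i => [|i IH].
    by rewrite perm1 -porbit_pre wE aK thx porbit_id.
  by rewrite expgSr permM -porbit_pre !wE aK thK.
have thO : stable th (porbit (a * th)%g x).
  apply/stableP => z zO; rewrite -[z]aK -wE porbit_pre.
  exact: (stableP _ _ aO).
have evO : ~~ odd #|porbit (a * th)%g x| by apply: (involution_even aK aO).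
have [z /andP[zO /eqP zfix]|no] :=
    pickP [pred z | (z \in porbit (a * th)%g x :\ x) && (th z == z)].
  case/setD1P: zO => /eqP zx zO.
  by have [//|<-] := fixA z (porbit_stable wA Ax zO) zfix.
(* Without another fixed point, [th] would pair off the orbit minus [x], which has odd size. *)
have : ~~ odd #|porbit (a * th)%g x :\ x|.
  apply: (involution_even thK) => [|z zO]; last by have /= := no z; rewrite zO /= => ->.
  apply/stableP => z /setD1P[zx zO]; apply/setD1P; split; last exact: (stableP _ _ thO).
  by rewrite -thx (inj_eq (@perm_inj _ th)).
by move: evO; rewrite (cardsD1 x (porbit _ _)) porbit_id /= => /negPn ->.
Qed.

Lemma order4_uniq (T : finType) (s : T -> T) x :
  injective s -> (forall d, s (s d) != d) -> s (s (s (s x))) = x ->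
  uniq [:: x; s x; s (s x); s (s (s x))].
Proof.
move=> sinj s2 s4.
have s1 d : s d != d by apply: contraNneq (s2 d) => E; rewrite !E.
rewrite /= !inE !negb_or !(inj_eq sinj) !(eq_sym _ (s _)) !s1 !s2 !andbT /=.
by rewrite -{2}s4 (inj_eq sinj) eq_sym s1.
Qed.

(** The square of [s] is [th] followed by the exchanges of the two opposite pairs at c. The first
    exchange joins a path inside [A] to one outside; the second then has both its darts on the
    joined orbit and splits it. *)
Lemma tau_count (T : finType) (a s : {perm T}) (A : {set T}) x :
  involutive a -> (forall d, a d != d) ->
  (forall d, s (s d) != d) -> (forall d, s (s (s (s d))) = d) ->
  stable a A ->
  (forall d, d \in A -> d \notin [:: x; s x; s (s x); s (s (s x))] -> s d \in A) ->
  x \in A -> s x \in A -> s (s x) \notin A -> s (s (s x)) \notin A ->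
  exists2 th : {perm T},
    forall d, th d = if d \in [:: x; s x; s (s x); s (s (s x))] then d else s (s d)
    & #|porbits (a * s * s)%g| = #|porbits (a * th)%g|.
Proof.
move=> aK afix s2 s4 aA.
have sinj := @perm_inj _ s.
have := order4_uniq sinj s2 (s4 x).
move sx: (s x) => x1; move sx1: (s x1) => x2; move sx2: (s x2) => x3 U sA Ax Ax1 nAx2 nAx3.
have sx3 : s x3 = x by rewrite -sx2 -sx1 -sx s4.
have : [&& x != x1, x != x2, x != x3, x1 != x2, x1 != x3 & x2 != x3].
  by move: U => /=; rewrite !inE !negb_or -!andbA andbT.
case/and5P=> n01 n02 n03 n12 /andP[n13 n23].
have [th D] : {u : {perm T} | u = (s * s * tperm x1 x3 * tperm x x2)%g} by eexists.
have sD d : d \notin [:: x; x1; x2; x3] -> s d \notin [:: x; x1; x2; x3].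
  have e y z : s y = z -> (s d == z) = (d == y) by move<-; rewrite (inj_eq sinj).
  rewrite !inE (e _ _ sx) (e _ _ sx1) (e _ _ sx2) (e _ _ sx3).
  by case/norP=> /negbTE-> /norP[/negbTE-> /norP[/negbTE-> /negbTE->]].
have thE d : th d = if d \in [:: x; x1; x2; x3] then d else s (s d).
  rewrite D !permM; case: ifP => [|/negbT /sD/sD].
    rewrite !inE => /or4P[]/eqP->; rewrite ?sx ?sx1 ?sx2 ?sx3 ?sx.
    - by rewrite (tpermD (z := x2)) ?tpermR // eq_sym.
    - by rewrite tpermR tpermD // eq_sym.
    - by rewrite (tpermD (z := x)) ?tpermL // eq_sym.
    - by rewrite tpermL tpermD // eq_sym.
  rewrite !inE !negb_or => /and4P[? ? ? ?].
  by rewrite (tpermD (x := x1)) ?tpermD // eq_sym.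
exists th => //.
have thK : involutive th.
  move=> d; rewrite (thE d); case: ifP => [dx|/negbT dx]; rewrite thE ?dx //.
  by rewrite (negbTE (sD _ (sD _ dx))) s4.
have thA : stable th A.
  apply/stableP => d dA; rewrite thE; case: ifP => // /negbT dx.
  exact: (sA _ (sA _ dA dx) (sD _ dx)).
have thfix d : th d = d -> d \in [:: x; x1; x2; x3].
  by rewrite thE; case: ifP => // _ /eqP; rewrite (negbTE (s2 d)).
have [w W] : {u : {perm T} | u = (a * th)%g} by eexists.
have wA : stable w A by rewrite W stableM.
have nx : x \notin porbit w x2.
  by apply: contra nAx2; rewrite porbit_sym; exact: porbit_stable.
have o1 : x1 \in porbit w x.
  rewrite W; apply: (mirror_orbit aK afix thK aA thA Ax); first by rewrite thE !inE eqxx.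
  move=> d dA /thfix; rewrite !inE => /or4P[]/eqP E; auto; move: dA; rewrite E.
    by rewrite (negbTE nAx2).
  by rewrite (negbTE nAx3).
have o3 : x3 \in porbit w x2.
  rewrite W; apply: (mirror_orbit aK afix thK (stableC aA) (stableC thA)).
  - by rewrite inE.
  - by rewrite thE !inE eqxx !orbT.
  move=> d; rewrite inE => dA /thfix; rewrite !inE => /or4P[]/eqP E; auto; move: dA; rewrite E.
    by rewrite Ax.
  by rewrite Ax1.
have [v V] : {u : {perm T} | u = (w * tperm x x2)%g} by eexists.
have ox : x \in porbit v x2 by rewrite V; exact: porbit_join.
(* The joined orbit contains both [x] and [x2], so undoing the transposition keeps it invariant; it
   therefore contains the whole [w]-orbits of [x] and [x2], and with them [x1] and [x3]. *)
have sO : stable w (porbit v x2).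
  have -> : w = (v * tperm x x2)%g by rewrite V mulg_tpermK.
  by rewrite stableM ?stable_porbit // stable_tperm // ox porbit_id.
have o13 : x1 \in porbit v x3.
  have v1 : x1 \in porbit v x2 by exact: porbit_stable sO ox o1.
  have v3 : x3 \in porbit v x2 by exact: porbit_stable sO (porbit_id _ _) o3.
  by move: v3; rewrite porbit_sym -eq_porbit_mem => /eqP <-.
have ss : (s * s)%g = (th * tperm x x2 * tperm x1 x3)%g by rewrite D !mulg_tpermK.
have -> : (a * s * s)%g = (v * tperm x1 x3)%g by rewrite -mulgA ss V W !mulgA.
by rewrite porbits_cut // -W (porbits_join nx) -V.
Qed.

(** * From plane maps to permutations, and the orbit count at c *)

(* The threading step once c has been cut into four univalent vertices: a
   traversal arriving at c turns back. *)
Definition cutstep (D : finType) (alpha sigma : D -> D) (c0 d : D) : D :=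
  if at_c sigma c0 (alpha d) then alpha d else sigma (sigma (alpha d)).

Lemma order4 (D : finType) (sigma : D -> D) x :
  injective sigma -> fingraph.order sigma x = 4 ->
  sigma (sigma (sigma (sigma x))) = x /\ sigma (sigma x) != x.
Proof.
move=> sinj ox; have := iter_order sinj x; have := orbit_uniq sigma x.
rewrite /fingraph.orbit ox /= !inE !negb_or => /and4P[/and3P[_ n _] _ _ _] ->.
by split=> //; rewrite eq_sym.
Qed.

Lemma fconnect4 (D : finType) (sigma : D -> D) x y : fingraph.order sigma x = 4 ->
  fconnect sigma x y = (y \in [:: x; sigma x; sigma (sigma x); sigma (sigma (sigma x))]).
Proof. by move=> ox; rewrite fconnect_orbit /fingraph.orbit ox. Qed.

Lemma glink_sym (D : finType) (alpha sigma : D -> D) :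
  involutive alpha -> symmetric (glink alpha sigma).
Proof.
move=> aK x y; rewrite /glink.
by rewrite (can2_eq aK aK x y) (eq_sym x) (orbC (sigma x == y)).
Qed.

(** Every edge has two darts, so adding E to both sides of Euler's formula turns its right side into
    [#|D|] plus twice the number of components; [d0] ensures that there is a component. *)
Lemma plane_map_porbits (D : finType) (alpha sigma : D -> D) (a s : {perm D}) (d0 : D) :
  plane_map alpha sigma -> a =1 alpha -> s =1 sigma ->
  #|D| + 2 <= #|porbits s| + #|porbits a| + #|porbits (a * s)%g|.
Proof.
move=> [aK afix sinj euler] aE sE.
rewrite (fcard_porbits sE) in euler.
have asE : (a * s)%g =1 sigma \o alpha by move=> d; rewrite permM /= aE sE.
rewrite (fcard_porbits asE) in euler.
have ca : fcard alpha predT * 2 = #|D|.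
  rewrite fcard_order_set //; first exact: inv_inj.
  apply/subsetP => z _; apply/eqP.
  rewrite (@order_cycle _ alpha [:: z; alpha z]) ?inE ?eqxx //=; first by rewrite aK !eqxx.
  by rewrite inE eq_sym afix.
rewrite (fcard_porbits aE) in euler ca.
have ncomp : 0 < n_comp (glink alpha sigma) predT.
  apply/card_gt0P; exists (root (glink alpha sigma) d0).
  rewrite inE /= andbT; apply: roots_root.
  exact/sym_connect_sym/glink_sym.
lia.
Qed.

(** Stated for an abstract side [A] so that it serves both the whole graph, with [A] the darts of
    one side, and each extended graph, with [A] the two darts of the loop. The last hypothesis says
    that each side is connected even if the darts at c are joined only through their edges. *)
Lemma count_split (D : finType) (alpha sigma : D -> D) (c0 : D) (A : {set D}) :
  plane_map alpha sigma -> four_regular sigma -> stable alpha A ->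
  (forall d, d \in A -> ~~ at_c sigma c0 d -> sigma d \in A) ->
  #|[set d in A | at_c sigma c0 d]| = 2 ->
  (forall (B : {set D}) b, stable alpha B ->
     (forall d, d \in B -> ~~ at_c sigma c0 d -> sigma d \in B) ->
     b \in B -> A \subset B \/ ~: A \subset B) ->
  fcard (fun d => sigma (sigma (alpha d))) predT = fcard (cutstep alpha sigma c0) predT.
Proof.
move=> pm r4 aA sA cA atoms; have [aK afix sinj _] := pm.
have s2 d : sigma (sigma d) != d by case: (order4 sinj (r4 d)).
have s4 d : sigma (sigma (sigma (sigma d))) = d by case: (order4 sinj (r4 d)).
have cE x d : at_c sigma c0 x ->
    at_c sigma c0 d = (d \in [:: x; sigma x; sigma (sigma x); sigma (sigma (sigma x))]).
  by move=> cx; rewrite -fconnect4 // /at_c /same_vertex; apply: same_connect (fconnect_sym sinj) _ _ cx _.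
have cS d : at_c sigma c0 (sigma d) = at_c sigma c0 d.
  by rewrite /at_c /same_vertex -same_fconnect1_r.
have [a aE] : {a : {perm D} | a =1 alpha}.
  by exists (perm (inv_inj aK)) => d; rewrite permE.
have [s sE] : {s : {perm D} | s =1 sigma}.
  by exists (perm sinj) => d; rewrite permE.
have planar := plane_map_porbits c0 pm aE sE.
have aKp : involutive a by move=> d; rewrite !aE.
have afixp d : a d != d by rewrite aE.
have s2p d : s (s d) != d by rewrite !sE.
have s4p d : s (s (s (s d))) = d by rewrite !sE.
have aAp : stable a A by apply/stableP => d; rewrite aE; exact: (stableP _ _ aA).
have cEp x d : at_c sigma c0 x ->
    (d \in [:: x; s x; s (s x); s (s (s x))]) = at_c sigma c0 d.
  by move=> cx; rewrite (cE x) // !sE.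
have sAp x d : at_c sigma c0 x -> d \in A ->
    d \notin [:: x; s x; s (s x); s (s (s x))] -> s d \in A.
  by move=> cx dA; rewrite cEp // sE; exact: sA.
have atc x y : at_c sigma c0 x -> fconnect sigma x y -> at_c sigma c0 y.
  by move=> cx; exact: connect_trans.
have done_ x : at_c sigma c0 x -> x \in A -> sigma x \in A ->
    sigma (sigma x) \notin A -> sigma (sigma (sigma x)) \notin A ->
    fcard (fun d => sigma (sigma (alpha d))) predT = fcard (cutstep alpha sigma c0) predT.
  move=> cx A0 A1 A2 A3.
  have := @tau_count D a s A x aKp afixp s2p s4p aAp (sAp x ^~ cx).
  rewrite !sE => /(_ A0 A1 A2 A3)[th thE E].
  rewrite (@fcard_porbits _ (a * s * s)%g); last by move=> d; rewrite !permM aE !sE.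
  rewrite (@fcard_porbits _ (a * th)%g) // => d.
  by rewrite permM thE -(cE x) // /cutstep aE !sE.
have alt x : at_c sigma c0 x -> x \in A -> sigma (sigma x) \in A ->
    sigma x \notin A -> sigma (sigma (sigma x)) \notin A -> False.
  move=> cx A0 A2 A1 A3.
  have := @no_alternation D a s A x (order4_uniq (@perm_inj _ s) s2p (s4p x)) (s4p x)
    planar aAp (sAp x ^~ cx).
  rewrite !sE; apply=> // B aB sB nB0 nB1; apply/eqP; apply: contraT => /set0Pn[b bB].
  have [||AB|AB] := atoms B b _ _ bB.
  - by apply/stableP => d dB; rewrite -aE; exact: (stableP _ _ aB).
  - by move=> d dB; rewrite -sE (cE x) //; exact: sB.
  - by rewrite (subsetP AB) in nB0.
  - by rewrite (subsetP AB) ?inE in nB1.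
have c00 : at_c sigma c0 c0 by exact: connect0.
have U : uniq [:: c0; sigma c0; sigma (sigma c0); sigma (sigma (sigma c0))] by exact: order4_uniq.
have {cA} : count (mem A) [:: c0; sigma c0; sigma (sigma c0); sigma (sigma (sigma c0))] = 2.
  rewrite -cA -size_filter -(card_uniqP (filter_uniq _ U)); apply: eq_card => d.
  by rewrite mem_filter !inE (cE c0) // !inE.
move=> /=.
have c1 : at_c sigma c0 (sigma c0) by rewrite cS.
have c2 : at_c sigma c0 (sigma (sigma c0)) by rewrite cS.
have c3 : at_c sigma c0 (sigma (sigma (sigma c0))) by rewrite cS.

(* Six placements of two darts of [A] among four: four are consecutive up to rotation, two
   alternate. *)
case A0: (c0 \in A); case A1: (sigma c0 \in A); case A2: (sigma (sigma c0) \in A);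
  case A3: (sigma (sigma (sigma c0)) \in A) => // _.
- by apply: (done_ c0); rewrite ?A2 ?A3.
- by case: (alt c0); rewrite ?A1 ?A3.
- by apply: (done_ (sigma (sigma (sigma c0)))); rewrite ?s4 ?A1 ?A2.
- by apply: (done_ (sigma c0)); rewrite ?s4 ?A0 ?A3.
- by case: (alt (sigma c0)); rewrite ?s4 ?A0 ?A2.
- by apply: (done_ (sigma (sigma c0))); rewrite ?s4 ?A1 ?A0.
Qed.

(** * Threaded circuits as pairs of orbits *)

Lemma thread_next (D : finType) (sigma : D -> D) h h' :
  injective sigma -> four_regular sigma -> thread sigma h h' -> h' = sigma (sigma h).
Proof.
move=> sinj r4; have [s4 _] := order4 sinj (r4 h).
rewrite /thread /same_vertex fconnect4 // => /and4P[+ n0 n1 n3].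
rewrite !inE => /or4P[]/eqP E //; move: n0 n1 n3; rewrite E ?s4 ?eqxx //.
Qed.

Lemma fcard_cycle (T : finType) (f : T -> T) (s : seq T) :
  injective f -> s != [::] -> uniq s -> fcycle f s -> fcard f [in s] = 1.
Proof.
move=> finj; case: s => // x s _ us cs.
rewrite -(n_comp_connect (fconnect_sym finj) x); apply: eq_n_comp_r => y.
by rewrite -[LHS](fconnect_cycle cs (mem_head x s)).
Qed.

(** Double counting of the orbit roots: each root's edge lies on exactly one circuit, and each
    circuit, with its reversal, carries exactly two roots. *)
Lemma circuits_fcard (D : finType) (alpha sigma : D -> D) (C : seq (seq D)) :
  involutive alpha -> injective sigma -> four_regular sigma ->
  threaded_circuit_partition alpha sigma C ->
  fcard (fun d => sigma (sigma (alpha d))) predT = 2 * size C.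
Proof.
move=> aK sinj r4 [Cth Ccount]; set tau := fun d => _.
have s4 d : sigma (sigma (sigma (sigma d))) = d by case: (order4 sinj (r4 d)).
have tinj : injective tau by move=> x y /sinj/sinj/(inv_inj aK).
transitivity (\sum_(d | froots tau d) \sum_(s <- C) edge_in alpha d s).
  transitivity #|froots tau|; first by apply: eq_card => d; rewrite !inE andbT.
  rewrite -sum1_card; apply: eq_bigr => d _.
  by rewrite -(Ccount d) -sum1_count big_mkcond; apply: eq_bigr => s _; case: edge_in.
rewrite exchange_big /=.
transitivity (\sum_(s <- C | s \in C) 2); last first.
  by rewrite -big_seq big_const_seq count_predT iter_addn_0.
rewrite big_seq; apply: eq_bigr => s /Cth /and3P[s0 us cs].
have cycs : fcycle tau s.
  by apply: sub_cycle cs => x y /(thread_next sinj r4) ->; exact: eqxx.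
(* Since [sigma] has order 4, [tau (alpha (tau x)) = alpha x]: the reversed circuit is followed by
   [tau] as well. *)
have cycr : fcycle tau (rev (map alpha s)).
  rewrite rev_cycle cycle_map; apply: sub_cycle cycs => x y /= /eqP<-.
  by rewrite /tau aK s4.
have /and3P[us1 dis us2] : [&& uniq s, ~~ has [in s] (map alpha s) & uniq (map alpha s)].
  by rewrite -cat_uniq.
have r0 : rev (map alpha s) != [::] by rewrite -size_eq0 size_rev size_map size_eq0.
have ur : uniq (rev (map alpha s)) by rewrite rev_uniq.
have <- : fcard tau [in s] + fcard tau [in rev (map alpha s)] = 2.
  by rewrite !fcard_cycle.
have fE (r : seq D) : fcard tau [in r] = \sum_d (froots tau d && (d \in r)).
  transitivity (\sum_(d | froots tau d && (d \in r)) 1).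
    by rewrite sum1_card; apply: eq_card => d; rewrite !inE.
  by rewrite big_mkcond; apply: eq_bigr => d _; case: (froots tau d && _).
rewrite !fE -big_split.
rewrite big_mkcond; apply: eq_bigr => d _ /=.
case: (froots tau d) => //=; rewrite /edge_in mem_rev.
have -> : (d \in map alpha s) = (alpha d \in s).
  by rewrite -{1}[d]aK mem_map //; exact: inv_inj.
have [ds|//] := boolP (d \in s); have [as_|//] := boolP (alpha d \in s).
by case/hasP: dis; exists d => //; rewrite -[d]aK map_f.
Qed.

(** * The components of G - c and the darts at c *)

Lemma link_minus_c_sym (D : finType) (alpha sigma : D -> D) c0 :
  involutive alpha -> connect_sym (link_minus_c alpha sigma c0).
Proof.
move=> aK; apply: sym_connect_sym => x y; rewrite /link_minus_c glink_sym //.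
by case: (at_c sigma c0 x); case: (at_c sigma c0 y).
Qed.

Lemma at_c_sigma (D : finType) (sigma : D -> D) c0 d :
  injective sigma -> at_c sigma c0 (sigma d) = at_c sigma c0 d.
Proof. by move=> sinj; rewrite /at_c /same_vertex -same_fconnect1_r. Qed.

Lemma link_minus_c_avoids (D : finType) (alpha sigma : D -> D) c0 k d :
  ~~ at_c sigma c0 k -> connect (link_minus_c alpha sigma c0) k d -> ~~ at_c sigma c0 d.
Proof.
move=> kc /connectP[p]; elim: p k kc => [|y p IH] k kc /= => [_ -> //|].
by case/andP=> /and3P[_ yc _]; exact: IH.
Qed.

Lemma link_minus_c_alpha (D : finType) (alpha sigma : D -> D) c0 k d :
  ~~ at_c sigma c0 d -> ~~ at_c sigma c0 (alpha d) ->
  connect (link_minus_c alpha sigma c0) k d ->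
  connect (link_minus_c alpha sigma c0) k (alpha d).
Proof.
move=> dc ac kd; apply: connect_trans kd (connect1 _).
by rewrite /link_minus_c /glink dc ac eqxx.
Qed.

Lemma link_minus_c_sigma (D : finType) (alpha sigma : D -> D) c0 k d :
  injective sigma -> ~~ at_c sigma c0 d ->
  connect (link_minus_c alpha sigma c0) k d ->
  connect (link_minus_c alpha sigma c0) k (sigma d).
Proof.
move=> sinj dc kd; apply: connect_trans kd (connect1 _).
by rewrite /link_minus_c /glink at_c_sigma // dc eqxx orbT.
Qed.

(* Handshake: the darts of a component of [G - c] are even in number, and so are
   those matched inside the component. *)
Lemma two_darts_to_component (D : finType) (alpha sigma : D -> D) c0 k :
  involutive alpha -> (forall d, alpha d != d) -> injective sigma ->
  four_regular sigma -> connected_map alpha sigma -> ~~ at_c sigma c0 k ->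
  2 <= #|[set x | at_c sigma c0 x && connect (link_minus_c alpha sigma c0) k (alpha x)]|.
Proof.
move=> aK afix sinj r4 conn kc; set N := [set x | _]; set L := link_minus_c alpha sigma c0.
have s2 d : sigma (sigma d) != d by case: (order4 sinj (r4 d)).
have s4 d : sigma (sigma (sigma (sigma d))) = d by case: (order4 sinj (r4 d)).
pose S := [set d | connect L k d].
have Sc d : d \in S -> ~~ at_c sigma c0 d by rewrite inE; exact: link_minus_c_avoids.
have Ss d : d \in S -> sigma d \in S.
  by move=> dS; have dc := Sc _ dS; move: dS; rewrite !inE; exact: link_minus_c_sigma.
(* Passing to the opposite dart at the same vertex is an involution without fixed points. *)
have evS : ~~ odd #|S|.
  apply: (@involution_even _ (fun d => sigma (sigma d))) => [d||//] //.
  by apply/stableP => d dS; rewrite !Ss.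
pose Sin := S :\: [set d | at_c sigma c0 (alpha d)].
have evSin : ~~ odd #|Sin|.
  apply: (involution_even aK) => [|//]; apply/stableP => d.
  rewrite !inE aK => /andP[ac kd]; rewrite link_minus_c_alpha ?andbT //.
    by apply: Sc; rewrite inE.
  by apply: Sc; rewrite inE.
have EN : S :&: [set d | at_c sigma c0 (alpha d)] = alpha @: N.
  apply/setP => d; have -> : (d \in alpha @: N) = (alpha d \in N).
    by rewrite -{1}[d]aK mem_imset //; exact: inv_inj.
  by rewrite !inE aK andbC.
have evN : ~~ odd #|N|.
  move: evS; rewrite -(cardsID [set d | at_c sigma c0 (alpha d)] S) oddD (negbTE evSin).
  by rewrite EN card_imset ?addbF //; exact: inv_inj.
suff : N != set0 by rewrite -card_gt0; case: #|N| evN => [|[|]].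
(* With no dart at c leading to it, the component would be closed in the connected graph and contain
   [c0]. *)
apply/eqP => N0; have cl : closed (glink alpha sigma) S.
  have gsym : connect_sym (glink alpha sigma) by exact/sym_connect_sym/glink_sym.
  apply: intro_closed => // x y /or3P[]/eqP E xS.
  - rewrite -E; have := xS; rewrite !inE; apply: link_minus_c_alpha; first exact: Sc.
    apply/negP => ac; have : x \in alpha @: N by rewrite -EN inE xS inE.
    by rewrite N0 imset0 inE.
  - by rewrite -E Ss.
  - by rewrite -[y]s4 E !Ss.
have := closed_connect cl (conn k c0); rewrite inE connect0.
by move/esym/Sc; rewrite /at_c /same_vertex connect0.
Qed.

(** Each component of G - c takes at least two of the four darts at c, so two components exhaust
    them: there is no third component and no loop at c. Hence the darts of the two subgraphs are
    complementary. *)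
Lemma cut_vertex_split (D : finType) (alpha sigma : D -> D) (c0 k1 : D) :
  involutive alpha -> (forall d, alpha d != d) -> injective sigma ->
  four_regular sigma -> connected_map alpha sigma -> cut_vertex alpha sigma c0 ->
  ~~ at_c sigma c0 k1 ->
  exists A : {set D},
  [/\ forall d, dart_of_sub alpha sigma c0 (inK1 alpha sigma c0 k1) d = (d \in A),
      forall d, dart_of_sub alpha sigma c0 (inK2 alpha sigma c0 k1) d = (d \notin A),
      forall d, ~~ at_c sigma c0 d -> (sigma d \in A) = (d \in A),
      #|[set d in A | at_c sigma c0 d]| = 2 /\ #|[set d in ~: A | at_c sigma c0 d]| = 2 &
      forall (B : {set D}) b, stable alpha B ->
        (forall d, d \in B -> ~~ at_c sigma c0 d -> sigma d \in B) ->
        b \in B -> A \subset B \/ ~: A \subset B].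
Proof.
move=> aK afix sinj r4 conn [x [y [xc yc nxy]]] k1c.
set L := link_minus_c alpha sigma c0 in nxy *.
have Lsym : connect_sym L by exact: link_minus_c_sym.
have s4 d : sigma (sigma (sigma (sigma d))) = d by case: (order4 sinj (r4 d)).
pose c d := at_c sigma c0 d.
have [k2 k2c nk12] : exists2 k2, ~~ c k2 & ~~ connect L k1 k2.
  have [k1x|?] := boolP (connect L k1 x); last by exists x.
  by exists y => //; rewrite (same_connect Lsym k1x).
pose N k := [set x | c x && connect L k (alpha x)].
have N2 k : ~~ c k -> 2 <= #|N k| by exact: two_darts_to_component.
have cardc : #|[set d | c d]| = 4 by rewrite -(r4 c0); apply: eq_card => d; rewrite inE.
have Ndisj k k' : ~~ connect L k k' -> N k :&: N k' = set0.
  move=> nkk; apply/setP => d; rewrite !inE; apply: contraNF nkk.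
  by case/andP=> /andP[_ kd] /andP[_]; rewrite Lsym; exact: connect_trans.
have cU k k' : #|N k :|: N k'| <= 4.
  by rewrite -cardc; apply/subset_leq_card/subsetP => d; rewrite !inE; case/orP=> /andP[].
have Ncard k k' : ~~ connect L k k' -> #|N k :|: N k'| = #|N k| + #|N k'|.
  by move=> nkk; rewrite cardsU Ndisj // cards0 subn0.
have N12 := Ncard _ _ nk12.
have [N1 N2'] : #|N k1| = 2 /\ #|N k2| = 2.
  have := cU k1 k2; rewrite N12; have := N2 _ k1c; have := N2 _ k2c.
  by move: #|N k1| #|N k2|; clear; lia.
have NU : N k1 :|: N k2 = [set d | c d].
  apply/eqP; rewrite eqEcard cardc N12 N1 N2' andbT.
  by apply/subsetP => d; rewrite !inE; case/orP=> /andP[].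
(* A third component would need a dart at c outside [N k1] and [N k2]. *)
have k12 k : ~~ c k -> connect L k1 k = ~~ connect L k2 k.
  move=> kc; have [/= k1k|nk1] := boolP (connect L k1 k).
    apply/esym; apply: contra nk12 => k2k; apply: connect_trans k1k _; by rewrite Lsym.
  apply/esym/negbTE; rewrite negbK; apply: contraT => nk2.
  have [d dN] : exists d, d \in N k by apply/card_gt0P; apply: leq_trans (N2 _ kc).
  have : d \in N k1 :|: N k2 by rewrite NU; move: dN; rewrite !inE => /andP[].
  case/setUP => dN'.
    by move/setP/(_ d): (Ndisj _ _ nk1); rewrite in_setI dN dN' inE.
  by move/setP/(_ d): (Ndisj _ _ nk2); rewrite in_setI dN dN' inE.
have ac d : c d -> ~~ c (alpha d).
  move=> cd; have : d \in N k1 :|: N k2 by rewrite NU inE.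
  by rewrite !inE cd /=; case/orP; exact: link_minus_c_avoids.
have av1 d : connect L k1 d -> ~~ c d by exact: link_minus_c_avoids.
have kalpha k d : ~~ c d -> ~~ c (alpha d) -> connect L k (alpha d) = connect L k d.
  move=> cd cad; apply/idP/idP => [|]; last exact: link_minus_c_alpha.
  by rewrite -{2}[d]aK; apply: link_minus_c_alpha; rewrite // aK.
pose A := [set d | connect L k1 d || connect L k1 (alpha d)].
have AE d : ~~ c d -> (d \in A) = connect L k1 d.
  move=> cd; rewrite in_set; have [//|nd] := boolP (connect L k1 d).
  apply/negbTE; apply: contra nd => kd; have := av1 _ kd => cad.
  by rewrite -kalpha.
have AEc d : c d -> (d \in A) = connect L k1 (alpha d).
  by move=> cd; rewrite in_set; have -> : connect L k1 d = false by apply: contraTF cd => /av1.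
exists A; split.
- move=> d; rewrite /dart_of_sub /inV_ /inK1 -/(c _) -/(c _) -/L.
  have [cd|cd] := boolP (c d); first by rewrite AEc // (negbTE (ac _ cd)).
  rewrite AE //=; have [cad|cad] := boolP (c (alpha d)); first by rewrite andbT.
  by rewrite /= kalpha // andbb.
- move=> d; rewrite /dart_of_sub /inV_ /inK2 -/(c _) -/(c _) -/L.
  have [cd|cd] := boolP (c d); first by rewrite AEc // (negbTE (ac _ cd)).
  rewrite AE //=; have [cad|cad] := boolP (c (alpha d)); first by rewrite andbT.
  by rewrite /= kalpha // andbb.
- move=> d cd; rewrite !AE ?/c ?at_c_sigma //; apply/idP/idP; last exact: link_minus_c_sigma.
  move=> h; rewrite -[d]s4; do 3!(apply: link_minus_c_sigma; rewrite ?at_c_sigma //).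
- have -> : [set d in A | at_c sigma c0 d] = N k1.
    apply/setP => d; rewrite in_set andbC [RHS]in_set; rewrite -/(c d).
    by case: (boolP (c d)) => //= cd; exact: AEc.
  split=> //; rewrite -N2'; congr #|pred_of_set _|; apply/setP => d.
  rewrite in_set in_setC andbC [RHS]in_set; rewrite -/(c d).
  case: (boolP (c d)) => //= cd.
  by rewrite AEc // k12 ?negbK // ac.
move=> B b /stableP aB sB bB.
(* A dart off c pulls its whole component into [B], and [alpha] then adds the darts at c leading to
   it. *)
have [b' b'B b'c] : exists2 b', b' \in B & ~~ c b'.
  have [/ac cb|] := boolP (c b); last by exists b.
  by exists (alpha b); rewrite ?aB.
have LB d : connect L b' d -> d \in B.
  have cl : closed L B.
    apply: intro_closed => // u v /and3P[uc vc /or3P[]/eqP E] uB.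
    - by rewrite -E aB.
    - by rewrite -E sB.
    - have w1 : sigma u \in B by apply: sB.
      have w2 : sigma (sigma u) \in B by apply: sB; rewrite // at_c_sigma.
      have : sigma (sigma (sigma u)) \in B by apply: sB; rewrite // !at_c_sigma.
      by rewrite -E s4.
  by move=> /(closed_connect cl) <-.
have [kb|kb] := boolP (connect L k1 b').
  left; apply/subsetP => d; rewrite inE; have k1B e : connect L k1 e -> e \in B.
    by move=> ke; apply: LB; rewrite -(same_connect Lsym kb).
  by case/orP=> [/k1B//|/k1B/aB]; rewrite aK.
right; apply/subsetP => d; rewrite inE => dA.
have kb2 : connect L k2 b' by rewrite -[connect _ _ _]negbK -k12.
have k2B e : connect L k2 e -> e \in B.
  by move=> ke; apply: LB; rewrite -(same_connect Lsym kb2).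
have [cd|cd] := boolP (c d).
  rewrite -[d]aK aB // k2B //; move: dA; rewrite AEc // k12 ?negbK //; exact: ac.
by apply: k2B; move: dA; rewrite AE // k12 // negbK.
Qed.

(** * Orbit count of a side closed up by a loop *)

Lemma cutstep_inj (D : finType) (alpha sigma : D -> D) c0 :
  involutive alpha -> injective sigma -> injective (cutstep alpha sigma c0).
Proof.
move=> aK sinj x y; rewrite /cutstep => E; apply: (inv_inj aK).
have cE z : at_c sigma c0 (if at_c sigma c0 z then z else sigma (sigma z)) = at_c sigma c0 z.
  by case: (boolP (at_c sigma c0 z)) => cz; rewrite ?at_c_sigma // (negbTE cz).
have := congr1 (at_c sigma c0) E; rewrite !cE => cxy.
by move: E; rewrite cxy; case: ifP => // _ /sinj/sinj.
Qed.

Lemma fclosed_stable (T : finType) (f : T -> T) (A : {set T}) :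
  injective f -> stable f A -> fclosed f A.
Proof.
move=> finj /stableP fA; apply: intro_closed; first exact: fconnect_sym.
by move=> x y /eqP<-; exact: fA.
Qed.

Lemma fcard_transfer (T T' : finType) (f : T -> T) (f' : T' -> T') (h : T -> T')
    (A : {set T}) (A' : {set T'}) (x0 : T) :
  injective f -> injective f' -> stable f A -> {in A &, injective h} ->
  {in A, forall x, h (f x) = f' (h x)} -> A' = h @: A -> x0 \notin A ->
  fcard f A = fcard f' A'.
Proof.
move=> finj f'inj fA hinj hf ->{A'} x0A.
(* The default [x0] lies outside [A], so [g y \in A] holds exactly for [y] in the image of [A]. *)
pose g y := if [pick x in A | h x == y] is Some x then x else x0.
have gK x : x \in A -> g (h x) = x.
  move=> xA; rewrite /g; case: pickP => [y /andP[yA /eqP /hinj-> //]|/(_ x)].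
  by rewrite xA eqxx.
have gA y : g y \in A -> h (g y) = y.
  rewrite /g; case: pickP => [x /andP[_ /eqP]//|_]; by rewrite (negbTE x0A).
have cl := fclosed_stable finj fA.
have sym := fconnect_sym finj; have sym' := fconnect_sym f'inj.
rewrite (@adjunction_n_comp _ _ g _ _ sym sym' _ cl).
  apply: eq_n_comp_r => y; rewrite [LHS]inE; apply/idP/imsetP => [yA|[x xA ->]].
    by exists (g y); rewrite ?gA.
  by rewrite gK.
apply: (intro_adjunction sym' cl (fun x _ => h x)) => [x xA|y yA].
  split=> [|z zA /eqP<-]; first by rewrite gK ?connect0.
  by rewrite hf // fconnect1.
split=> [|z /eqP<-]; first by rewrite gA.
by rewrite -{2}[y]gA // -hf // gK ?fconnect1 //; exact: (stableP _ _ fA).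
Qed.

Lemma order_fconnect (T : finType) (f : T -> T) x y :
  injective f -> fconnect f x y -> fingraph.order f y = fingraph.order f x.
Proof.
move=> finj xy; apply: eq_card => z; rewrite !inE.
by rewrite (same_connect (fconnect_sym finj) xy).
Qed.

(** [count_split] applies with the loop as one side. On the other side the cut step is conjugate,
    through [f], to the one on [A]; the final 1 is the orbit of the loop. *)
Lemma loop_extension_count (D : finType) (alpha sigma : D -> D) (c0 : D)
    (K : pred D) (A : {set D}) (d0 : D)
    (D' : finType) (alpha' sigma' : D' -> D') (f : D -> D') (l : D') :
  involutive alpha -> injective sigma -> four_regular sigma ->
  (forall d, dart_of_sub alpha sigma c0 K d = (d \in A)) ->
  (forall d, ~~ at_c sigma c0 d -> d \in A -> sigma d \in A) ->
  #|[set d in A | at_c sigma c0 d]| = 2 -> d0 \notin A ->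
  (forall (B : {set D}) b, stable alpha B ->
     (forall d, d \in B -> ~~ at_c sigma c0 d -> sigma d \in B) ->
     b \in B -> B \subset A -> A \subset B) ->
  loop_extension alpha sigma c0 K alpha' sigma' f l ->
  plane_map alpha' sigma' ->
  four_regular sigma' /\
  fcard (fun d => sigma' (sigma' (alpha' d))) predT
    = fcard (cutstep alpha sigma c0) A + 1.
Proof.
move=> aK sinj r4 KA sA cA d0A atom [finj cover fnl [fa fs fc]] pm'.
have [aK' afix' sinj' _] := pm'.
have aA d : d \in A -> alpha d \in A.
  by rewrite -!KA /dart_of_sub aK andbC.
have {}finj : {in A &, injective f} by move=> x y xA yA; apply: finj; rewrite -topredE /= KA.
have {}fnl d : d \in A -> f d != l /\ f d != alpha' l by rewrite -KA; exact: fnl.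
have {}fa d : d \in A -> alpha' (f d) = f (alpha d) by rewrite -KA; exact: fa.
have {}fs d : d \in A -> ~~ at_c sigma c0 d -> sigma' (f d) = f (sigma d).
  by rewrite -KA; exact: fs.
have {}fc d : d \in A -> at_c sigma c0 d -> at_c sigma' l (f d) /\ at_c sigma' l (alpha' l).
  move=> dA cd; rewrite -KA in dA; have [h1 h2] := fc d dA cd.
  have sy := fconnect_sym sinj'.
  by rewrite /at_c /same_vertex; split; [rewrite sy | rewrite -(same_connect sy h1)].
have {}cover x : [\/ x = l, x = alpha' l | exists2 d, d \in A & x = f d].
  case: (cover x) => [?|?|[d dA ->]]; [exact: Or31 | exact: Or32 | apply: Or33].
  by exists d; rewrite -?KA.
(* The images of the darts of [A] off c form a [sigma']-invariant set avoiding [l]. *)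
have csplit d : d \in A -> at_c sigma' l (f d) = at_c sigma c0 d.
  move=> dA; have [cd|cd] := boolP (at_c sigma c0 d); first by case: (fc d).
  pose F := f @: [set d in A | ~~ at_c sigma c0 d].
  have sF : stable sigma' F.
    apply/stableP => _ /imsetP[e /[!inE]/andP[eA ce] ->]; rewrite fs //.
    by apply: imset_f; rewrite inE sA //= at_c_sigma.
  have FfS : f d \in F by apply: imset_f; rewrite inE dA.
  rewrite /at_c /same_vertex (fconnect_sym sinj').
  apply/negP => /(closed_connect (fclosed_stable sinj' sF)); rewrite FfS => /esym.
  by case/imsetP=> e /[!inE] /andP[eA _] E; have [/eqP] := fnl e eA; rewrite E.
have cl : at_c sigma' l l by exact: connect0.
have cal : at_c sigma' l (alpha' l).
  have /card_gt0P[d] : 0 < #|[set d in A | at_c sigma c0 d]| by rewrite cA.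
  by rewrite inE => /andP[dA cd]; case: (fc d dA cd).
have Ec : [set x | at_c sigma' l x] = [set l; alpha' l] :|: f @: [set d in A | at_c sigma c0 d].
  apply/setP => x; rewrite !inE; apply/idP/idP.
    case: (cover x) => [->|->|[d dA ->]]; rewrite ?eqxx ?orbT // csplit // => cd.
    by apply/orP; right; apply: imset_f; rewrite inE dA.
  case/orP=> [/orP[]/eqP->//|/imsetP[d /[!inE] /andP[dA cd] ->]].
  by rewrite csplit.
have ol : fingraph.order sigma' l = 4.
  transitivity #|[set x | at_c sigma' l x]|; first by apply: eq_card => x; rewrite inE.
  rewrite Ec cardsU cards2 (eq_sym l) afix' card_in_imset; last first.
    by move=> x y /[!inE] /andP[xA _] /andP[yA _]; exact: finj.
  rewrite cA (_ : _ :&: _ = set0) ?cards0 //; apply/setP => x; rewrite !inE.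
  apply/negP => /andP[/orP[]/eqP-> /imsetP[d /[!inE] /andP[dA _] E]].
    by have [/eqP] := fnl d dA; rewrite -E.
  by have [_ /eqP] := fnl d dA; rewrite -E.
have r4' : four_regular sigma'.
  move=> x; have [cx|] := boolP (at_c sigma' l x); first by rewrite (order_fconnect sinj' cx).
  case: (cover x) => [->|->|[d dA ->]]; rewrite ?cl ?cal // csplit // => cd.
  have [s4 s2] := order4 sinj (r4 d).
  have s1A : sigma d \in A by exact: sA.
  have s2A : sigma (sigma d) \in A by rewrite sA // at_c_sigma.
  have s3A : sigma (sigma (sigma d)) \in A by rewrite sA // !at_c_sigma.
  rewrite (@order_cycle _ sigma' (map f [:: d; sigma d; sigma (sigma d); sigma (sigma (sigma d))])).
  - by [].
  - by rewrite /= !fs // ?at_c_sigma // s4 !eqxx.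
  - rewrite map_inj_in_uniq ?order4_uniq // => [z|u v].
      by case: (order4 sinj (r4 z)).
    rewrite !inE => hu hv; apply: finj.
      by case/or4P: hu => /eqP->.
    by case/or4P: hv => /eqP->.
  - exact: mem_head.
split=> //; pose A' := [set l; alpha' l].
have coverA' x : x \notin A' -> exists2 d, d \in A & x = f d.
  by case: (cover x) => [->|->|//]; rewrite !inE eqxx ?orbT.
have fA' d : d \in A -> f d \notin A'.
  by move=> dA; rewrite !inE negb_or; have [-> ->] := fnl d dA.
have A'E : ~: A' = f @: A.
  apply/setP => x; rewrite in_setC; apply/idP/imsetP => [/coverA'[d ? ->]|[d dA ->]].
    by exists d.
  exact: fA'.
have aA' : stable alpha' A'.
  by apply/stableP => x; rewrite !inE => /orP[]/eqP->; rewrite ?aK' eqxx ?orbT.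
have cA' x : x \in A' -> at_c sigma' l x by rewrite !inE => /orP[]/eqP->.
rewrite (count_split (c0 := l) (A := A') pm' r4') //; first last.
- move=> B b /stableP aB sB bB; have [bA'|/coverA'[d dA E]] := boolP (b \in A').
    left; have lB : l \in B.
      by move: bA'; rewrite !inE => /orP[]/eqP E; [rewrite -E | rewrite -[l]aK' -E aB].
    by apply/subsetP => x; rewrite !inE => /orP[]/eqP->; rewrite ?aB.
  right; pose B0 := [set d in A | f d \in B].
  have AB0 : A \subset B0.
    apply: (atom B0 d).
    - by apply/stableP => e; rewrite !inE => /andP[eA eB]; rewrite aA // -fa // aB.
    - move=> e; rewrite !inE => /andP[eA eB] ce; rewrite sA // -fs // sB // csplit //.
    - by rewrite inE dA -E.
    - by apply/subsetP => e; rewrite inE => /andP[].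
  rewrite A'E; apply/subsetP => _ /imsetP[e eA ->].
  by move/subsetP/(_ e eA): AB0; rewrite inE => /andP[].
- have -> : [set x in A' | at_c sigma' l x] = A'.
    by apply/setP => x; rewrite inE; case: (boolP (x \in A')) => // /cA'.
  by rewrite cards2 eq_sym afix'.
- by move=> x /cA' ->.
have cinj := cutstep_inj (c0 := c0) aK sinj.
have cinj' := cutstep_inj (c0 := l) aK' sinj'.
have cutA d : d \in A -> cutstep alpha sigma c0 d \in A.
  move=> dA; rewrite /cutstep; case: ifP => [_|/negbT ca]; first exact: aA.
  by rewrite !sA ?at_c_sigma ?aA.
(* With c cut open, the loop is the 2-cycle of [l] and [alpha' l]. *)
rewrite (n_compC A') addnC; congr (_ + _); last first.
  transitivity (fcard (cutstep alpha' sigma' l) [in [:: l; alpha' l]]).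
    by apply: eq_n_comp_r => x; rewrite !inE.
  rewrite fcard_cycle //=; first by rewrite inE andbT eq_sym afix'.
  by rewrite /cutstep aK' cal cl !eqxx.
transitivity (fcard (cutstep alpha' sigma' l) (~: A')).
  by apply: eq_n_comp_r => x; rewrite !inE.
apply/esym; apply: (fcard_transfer (h := f) cinj cinj' _ finj _ A'E d0A).
  by apply/stableP.
move=> d dA; rewrite /cutstep fa // csplit ?aA //; case: ifP => // /negbT ca.
by rewrite !fs ?sA ?at_c_sigma ?aA.
Qed.

(** * Assembly of the three counts *)

Theorem mainTheorem2
  (D : finType) (alpha sigma : D -> D) (c0 k1 : D)
  (D1 : finType) (alpha1 sigma1 : D1 -> D1) (f1 : D -> D1) (l1 : D1)
  (D2 : finType) (alpha2 sigma2 : D2 -> D2) (f2 : D -> D2) (l2 : D2)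
  (C : seq (seq D)) (C1 : seq (seq D1)) (C2 : seq (seq D2)) :
  plane_map alpha sigma -> four_regular sigma -> connected_map alpha sigma ->
  cut_vertex alpha sigma c0 -> ~~ at_c sigma c0 k1 ->
  loop_extension alpha sigma c0 (inK1 alpha sigma c0 k1) alpha1 sigma1 f1 l1 ->
  plane_map alpha1 sigma1 ->
  loop_extension alpha sigma c0 (inK2 alpha sigma c0 k1) alpha2 sigma2 f2 l2 ->
  plane_map alpha2 sigma2 ->
  threaded_circuit_partition alpha sigma C ->
  threaded_circuit_partition alpha1 sigma1 C1 ->
  threaded_circuit_partition alpha2 sigma2 C2 ->
  size C = size C1 + size C2 - 1.
Proof.
move=> pm r4 conn cut k1c ext1 pm1 ext2 pm2 HC HC1 HC2.
have [aK afix sinj _] := pm.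
have [aK1 _ sinj1 _] := pm1; have [aK2 _ sinj2 _] := pm2.
have [A [K1A K2A sA [cA cAc] atoms]] := cut_vertex_split aK afix sinj r4 conn cut k1c.
have [d1 d1A] : exists d, d \in A.
  have /card_gt0P[d] : 0 < #|[set d in A | at_c sigma c0 d]| by rewrite cA.
  by rewrite inE => /andP[]; exists d.
have [d2 d2A] : exists d, d \notin A.
  have /card_gt0P[d] : 0 < #|[set d in ~: A | at_c sigma c0 d]| by rewrite cAc.
  by rewrite inE in_setC => /andP[]; exists d.
have aA : stable alpha A.
  by apply/stableP => d; rewrite -!K1A /dart_of_sub aK andbC.
have [r41 E1] : four_regular sigma1 /\ fcard (fun d => sigma1 (sigma1 (alpha1 d))) predT
    = fcard (cutstep alpha sigma c0) A + 1.
  apply: (loop_extension_count aK sinj r4 K1A _ cA d2A _ ext1 pm1).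
    by move=> d cd; rewrite sA.
  move=> B b aB sB bB BA; have [//|AcB] := atoms B b aB sB bB.
  have d2B : d2 \in B by apply: (subsetP AcB); rewrite inE.
  by rewrite (subsetP BA) in d2A.
have [r42 E2] : four_regular sigma2 /\ fcard (fun d => sigma2 (sigma2 (alpha2 d))) predT
    = fcard (cutstep alpha sigma c0) (~: A) + 1.
  apply: (loop_extension_count (d0 := d1) aK sinj r4 _ _ cAc _ _ ext2 pm2).
  - by move=> d; rewrite K2A inE.
  - by move=> d cd; rewrite !inE sA.
  - by rewrite inE negbK.
  move=> B b aB sB bB BA; have [AB|//] := atoms B b aB sB bB.
  by have := subsetP BA _ (subsetP AB _ d1A); rewrite inE d1A.
have := circuits_fcard aK sinj r4 HC.
rewrite (count_split (c0 := c0) pm r4 aA _ cA atoms); last by move=> d dA cd; rewrite sA.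
have := circuits_fcard aK1 sinj1 r41 HC1; have := circuits_fcard aK2 sinj2 r42 HC2.
rewrite E1 E2 (n_compC A).
have -> : fcard (cutstep alpha sigma c0) [predC A] = fcard (cutstep alpha sigma c0) (~: A).
  by apply: eq_n_comp_r => d; rewrite !inE.
(* If n1 and n2 count the cut orbits on the two sides, the doubled sizes of [C], [C1], [C2] are n1 +
   n2, n1 + 1 and n2 + 1. In particular [C1] is nonempty and the subtraction does not truncate. *)
move: (fcard _ A) (fcard _ (~: A)) (size C) (size C1) (size C2); clear; lia.
Qed.
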